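(* For every integer $m\ge 3$, there are infinitely many primitive quaternary $m$-gonal forms $\langle a_1,a_2,a_3,a_4\rangle_m$ (with $a_1,a_2,a_3,a_4$ positive integers) which are not almost regular over $\mathbb{Z}$ (and so also not almost regular over $\mathbb{N}_0$).
   Context: For an integer $m\ge 3$ and an integer $x$, put $P_m(x):=\frac{m-2}{2}(x^2-x)+x$. For positive integers $a_1,\dots,a_n$, the $m$-gonal form $\langle a_1,\dots,a_n\rangle_m$ is $F_m(\mathbf{x})=a_1P_m(x_1)+\cdots+a_nP_m(x_n)$; it is quaternary if $n=4$, and primitive if $\gcd(a_1,\dots,a_n)=1$. $\mathbb{N}_0$ is the set of non-negative integers. The form $F_m$ represents a positive integer $N$ over $\mathbb{Z}$ (resp. over $\mathbb{N}_0$) if $F_m(\mathbf{x})=N$ has a solution $\mathbf{x}\in\mathbb{Z}^n$ (resp. $\mathbf{x}\in\mathbb{N}_0^n$). The form $F_m$ locally represents $N$ if for every positive integer $r$ the congruence $F_m(\mathbf{x})\equiv N\pmod r$ has a solution $\mathbf{x}\in\mathbb{Z}^n$ (equivalently, $\mathbf{x}\in\mathbb{N}_0^n$). The form $F_m$ is almost regular over $\mathbb{Z}$ (resp. over $\mathbb{N}_0$) if it represents over $\mathbb{Z}$ (resp. over $\mathbb{N}_0$) all but finitely many of the positive integers $N$ that it locally represents. *)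

(* Defs.v *)
From mathcomp Require Import all_boot all_order all_algebra.
From mathcomp Require Import boolp classical_sets cardinality.
From mathcomp Require Import zify ring.

Set Implicit Arguments.
Unset Strict Implicit.
Unset Printing Implicit Defensive.

Import Order.TTheory GRing.Theory Num.Theory.

Local Open Scope classical_set_scope.
Local Open Scope ring_scope.

(* The division by 2 is exact: see [polygonalE]. *)
Definition polygonal (m x : int) : int :=
  ((m - 2) * (x ^+ 2 - x) %/ 2)%Z + x.

Lemma polygonalE (m x : int) :
  (polygonal m x)%:~R = (m - 2)%:~R / 2 * (x ^+ 2 - x)%:~R + x%:~R :> rat.
Proof.
have /dvdzP[q Eq] : (2 %| x ^+ 2 - x)%Z.
  have -> : x ^+ 2 - x = x * (x - 1) by ring.
  have [k [-> | ->]] : exists k : int, x = k * 2 \/ x = k * 2 + 1.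
    exists (x %/ 2)%Z; lia.
  - by rewrite -mulrA mulrCA dvdz_mulr.
  - by rewrite addrK mulrA dvdz_mull.
rewrite /polygonal Eq mulrA mulzK // intrD !intrM; congr (_ + _).
by field.
Qed.

(* The m-gonal form <a_1, ..., a_n>_m is given by its tuple of coefficients;
   they are natural numbers, required to be positive by [positive_coefs]. *)
Definition mgonal_form (m : int) (n : nat) (a : n.-tuple nat)
    (x : n.-tuple int) : int :=
  \sum_(i < n) (tnth a i)%:Z * polygonal m (tnth x i).

Definition positive_coefs (n : nat) (a : n.-tuple nat) : Prop :=
  forall i : 'I_n, (0 < tnth a i)%N.

Definition primitive (n : nat) (a : n.-tuple nat) : Prop :=
  \big[gcdn/0%N]_(i < n) tnth a i = 1%N.

Definition nonneg_int : set int := [set x | 0 <= x].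

(* Representation over a set D of integers; D is [setT] for Z and
   [nonneg_int] for N_0. *)
Definition represents (D : set int) (m : int) (n : nat) (a : n.-tuple nat)
    (N : nat) : Prop :=
  exists x : n.-tuple int,
    (forall i : 'I_n, D (tnth x i)) /\ mgonal_form m a x = N%:Z.

Definition locally_represents (m : int) (n : nat) (a : n.-tuple nat)
    (N : nat) : Prop :=
  forall r : nat, (0 < r)%N ->
    exists x : n.-tuple int, (mgonal_form m a x = N%:Z %[mod r%:Z])%Z.

Definition almost_regular (D : set int) (m : int) (n : nat)
    (a : n.-tuple nat) : Prop :=
  finite_set [set N : nat | [/\ (0 < N)%N, locally_represents m a N
                              & ~ represents D m a N]].

(* Main.v *)
Require Import Defs.
From mathcomp Require Import all_boot all_order all_algebra.
From mathcomp Require Import boolp classical_sets cardinality.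
From mathcomp Require Import cyclic zify ring.

Set Implicit Arguments.
Unset Strict Implicit.
Unset Printing Implicit Defensive.

Import Order.TTheory GRing.Theory Num.Theory.

Local Open Scope classical_set_scope.
Local Open Scope ring_scope.

(** Completing the square turns F(x) = N into the equation
      sum_i a_i y_i^2 = 8 (m - 2) N + (m - 4)^2 sum_i a_i,
    with every y_i = 2 (m - 2) x_i - (m - 4), that is, with y_i running over a
    fixed residue class modulo 2 (m - 2).

    Suppose that the diagonal form sum_i a_i y_i^2 is anisotropic at a prime p
    coprime to 2 (m - 2), and let T be a power of p congruent to 1 modulo
    8 (m - 2). Multiplying y by T preserves the residue class and multiplies the
    right-hand side by T^2, so it sends N to some larger N' which is locally
    represented if N is ([locally_represents_dilated]). Conversely, anisotropy
    forces T to divide any y that solves the equation for N', so N is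
    represented if N' is ([represents_undilated]). Hence a single N > 0 that is
    locally but not globally represented yields infinitely many of them
    ([anisotropic_not_almost_regular]).

    Such an N is found for the forms <s^2, t^2, p u, p u> with s and t coprime.
    If N = s^2 P_m(e / s) = t^2 P_m(f / t) for integers e and f, then N is
    represented by s^2 P_m modulo every r coprime to s, by t^2 P_m modulo every
    r coprime to t, hence by their sum modulo every r
    ([locally_represents_two_squares]). If moreover N is smaller than every
    coefficient, it is not represented, because P_m is non-negative on the
    integers ([not_represents_small]). Suitable s, t, e, f depending on m are
    written down in [common_value_exists]. Finally, p is taken to be a prime
    divisor of 4 |m - 2| s t - 1 congruent to 3 modulo 4: then -1 is not a square
    modulo p, which makes the form anisotropic at p for every u prime to p
    ([anisotropic_two_squares]), and u can be arbitrarily large. *)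

Lemma PoszX (p k : nat) : (p ^ k)%N%:Z = p%:Z ^+ k.
Proof. by rewrite -natz natrX natz. Qed.

Lemma unbounded_infinite (A : set nat) :
  (forall b : nat, exists2 n, A n & (b < n)%N) -> infinite_set A.
Proof.
move=> unbA /finite_seqP[s As].
have [n An] := unbA (\max_(i <- s) i)%N.
rewrite ltnNge; have ns : n \in s by move: An; rewrite As.
by rewrite (@leq_bigmax_seq _ s xpredT id n ns).
Qed.

(** * Arithmetic of primes congruent to 3 modulo 4 *)

(** Otherwise all prime divisors of k would be 1 modulo 4, since k is odd, and
    so would k itself. *)
Lemma prime_divisor_3mod4 (k : nat) :
  (k %% 4 = 3)%N -> exists p : nat, [/\ prime p, (p %% 4 = 3)%N & (p %| k)%N].
Proof.
have [j] := ubnP k; elim: j k => // j IHj k le_kj k3.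
have k_gt1 : (1 < k)%N by lia.
have p_pr := pdiv_prime k_gt1; have /dvdnP[q Dk] := pdiv_dvd k.
move: (pdiv k) p_pr Dk => p p_pr Dk; have p_gt1 := prime_gt1 p_pr.
have [p3|p3] := eqVneq (p %% 4)%N 3%N; first by exists p; rewrite Dk dvdn_mull.
have q3 : (q %% 4 = 3)%N.
  have := modnMm q p 4; rewrite -Dk k3.
  have : (q %% 4 < 4)%N by rewrite ltn_mod.
  have : (p %% 4 < 4)%N by rewrite ltn_mod.
  move: (p %% 4)%N (q %% 4)%N p3 => [|[|[|[|?]]]] [|[|[|[|?]]]] //.
have q_gt0 : (0 < q)%N by lia.
have lt_qj : (q < j)%N by nia.
have [l [l_pr l3 lq]] := IHj q lt_qj q3.
by exists l; split=> //; rewrite Dk dvdn_mulr.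
Qed.

Lemma dvdz_fermat (p : nat) (a : int) : prime p -> (p %% 4 = 3)%N ->
  ~~ (p%:Z %| a)%Z -> (p%:Z %| a ^+ p.-1 - 1)%Z.
Proof.
move=> p_pr p3 pNa.
(* The exponent is even, so that a may be replaced by its absolute value. *)
have Dp : p.-1 = ((p %/ 4).*2.+1 * 2)%N by lia.
have -> : a ^+ p.-1 = (`|a| ^ p.-1)%N%:Z.
  by rewrite PoszX Dp mulnC !exprM abszE real_normK ?num_real.
have co : coprime `|a| p by rewrite coprime_sym prime_coprime.
have := Euler_exp_totient co; rewrite totient_prime // => E.
by rewrite -eqz_mod_dvd !modz_nat E.
Qed.

(** Were a and b prime to p, raising a^2 = - b^2 to the odd power (p - 1) / 2
    would give 1 = - 1 modulo p by Fermat's little theorem. *)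
Lemma dvdz_sqr_sum_3mod4 (p : nat) (a b : int) :
  prime p -> (p %% 4 = 3)%N -> (p%:Z %| a ^+ 2 + b ^+ 2)%Z ->
  (p%:Z %| a)%Z /\ (p%:Z %| b)%Z.
Proof.
move=> p_pr p3; have Dp : p.-1 = (2 * (p %/ 4).*2.+1)%N by lia.
move=> pab.
have dvd_sqr (c : int) : (p%:Z %| c ^+ 2)%Z = (p%:Z %| c)%Z.
  by rewrite !dvdzE abszX Euclid_dvdX ?andbT.
have ab : (p%:Z %| a)%Z = (p%:Z %| b)%Z.
  rewrite -(dvd_sqr a) -(dvd_sqr b); apply/idP/idP => pc.
    by rewrite -(addKr (a ^+ 2) (b ^+ 2)) addrC rpredB.
  by rewrite -(addrK (b ^+ 2) (a ^+ 2)) rpredB.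
suff pa : (p%:Z %| a)%Z by rewrite -ab.
apply/negPn/negP => pNa; have pNb : ~~ (p%:Z %| b)%Z by rewrite -ab.
have pS : (p%:Z %| a ^+ p.-1 + b ^+ p.-1)%Z.
  apply: (dvdz_trans pab); rewrite Dp !exprM.
  have := subrXX (a ^+ 2) (- b ^+ 2) (p %/ 4).*2.+1.
  by rewrite opprK exprNn -signr_odd /= odd_double expr1 mulN1r opprK => ->;
    rewrite dvdz_mulr.
have := dvdz_fermat p_pr p3 pNb; have := dvdz_fermat p_pr p3 pNa.
move: (a ^+ _) (b ^+ _) pS => A B pS pA pB.
have : (p%:Z %| 2%:R)%Z.
  have -> : 2 = (A + B) - (A - 1) - (B - 1) by ring.
  exact: rpredB (rpredB pS pA) pB.
by rewrite dvdzE => /(@dvdn_leq _ 2 isT) /= p_le2; clear -p3 p_le2; lia.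
Qed.

(** * Completing the square *)

Lemma double_polygonal (m x : int) :
  2 * polygonal m x = (m - 2) * x ^+ 2 - (m - 4) * x.
Proof.
apply/eqP; rewrite -(eqr_int rat) intrM polygonalE; apply/eqP.
by rewrite !(rmorphM, rmorphB, rmorphXn) /=; field.
Qed.

Lemma polygonal_ge0 (m x : int) : 3 <= m -> 0 <= polygonal m x.
Proof.
move=> m3; rewrite -(pmulr_rge0 _ (_ : 0 < 2)) // double_polygonal.
have -> : (m - 2) * x ^+ 2 - (m - 4) * x = x * ((m - 2) * (x - 1) + 2) by ring.
have [x1|x0] := lerP 1 x; first by rewrite mulr_ge0 //; nia.
have [->|x_neq0] := eqVneq x 0; first by rewrite mul0r.
by rewrite mulr_le0 //; nia.
Qed.

Definition completed (m x : int) : int := 2 * (m - 2) * x - (m - 4).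

Definition diag_form (n : nat) (a : n.-tuple nat) (y : 'I_n -> int) : int :=
  \sum_(i < n) (tnth a i)%:Z * y i ^+ 2.

Definition coef_sum (n : nat) (a : n.-tuple nat) : int :=
  \sum_(i < n) (tnth a i)%:Z.

Lemma complete_square (m : int) (n : nat) (a : n.-tuple nat) x :
  diag_form a (fun i => completed m (tnth x i)) =
  8 * (m - 2) * mgonal_form m a x + (m - 4) ^+ 2 * coef_sum a.
Proof.
rewrite /mgonal_form /coef_sum !mulr_sumr -big_split; apply: eq_bigr => i _ /=.
have -> : 8 * (m - 2) * ((tnth a i)%:Z * polygonal m (tnth x i)) =
  4 * (m - 2) * (tnth a i)%:Z * (2 * polygonal m (tnth x i)) by ring.
by rewrite double_polygonal /completed; ring.
Qed.

(** * Dilation by a power of an anisotropic prime *)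

(** With T = 1 + 8 (m - 2) h, this is the number N' for which the right-hand
    side 8 (m - 2) N' + (m - 4)^2 sum_i a_i of the completed equation is T^2
    times the one for N (see [dilated_valueE]). *)
Definition dilated_value (m : int) (n : nat) (a : n.-tuple nat)
    (h N : int) : int :=
  (1 + 8 * (m - 2) * h) ^+ 2 * N
  + h * (2 + 8 * (m - 2) * h) * (m - 4) ^+ 2 * coef_sum a.

Lemma dilated_valueE (m : int) (n : nat) (a : n.-tuple nat) (h N : int) :
  8 * (m - 2) * dilated_value m a h N + (m - 4) ^+ 2 * coef_sum a =
  (1 + 8 * (m - 2) * h) ^+ 2 * (8 * (m - 2) * N + (m - 4) ^+ 2 * coef_sum a).
Proof. by rewrite /dilated_value; ring. Qed.

(** The transfer principle used in both directions of the dilation argument: a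
    value of the form can be read off from the diagonal form. *)
Lemma mgonal_form_eq (m : int) (n : nat) (a : n.-tuple nat) x (N : int) :
  3 <= m ->
  diag_form a (fun i => completed m (tnth x i)) =
    8 * (m - 2) * N + (m - 4) ^+ 2 * coef_sum a ->
  mgonal_form m a x = N.
Proof.
move=> m3; rewrite complete_square => /addIr /mulfI; apply; lia.
Qed.

Lemma diag_formZ (n : nat) (a : n.-tuple nat) (c : int) y z :
  (forall i, y i = c * z i) -> diag_form a y = c ^+ 2 * diag_form a z.
Proof.
move=> yz; rewrite /diag_form mulr_sumr; apply: eq_bigr => i _.
by rewrite yz; ring.
Qed.

(** Since T = 1 modulo 2 (m - 2), the map y -> T y on completed variables comes
    from an integral map on x, namely x -> T x - 4 (m - 4) h, and this works
    modulo every r at once. *)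
Lemma locally_represents_dilated (m : int) (n : nat) (a : n.-tuple nat)
    (h : int) (N N' : nat) :
  3 <= m -> N'%:Z = dilated_value m a h N ->
  locally_represents m a N -> locally_represents m a N'.
Proof.
move=> m3 DN' locN r r_gt0; have [x Fx] := locN r r_gt0.
set T := 1 + 8 * (m - 2) * h.
exists [tuple T * tnth x i - 4 * (m - 4) * h | i < n].
have -> : mgonal_form m a [tuple T * tnth x i - 4 * (m - 4) * h | i < n] =
    dilated_value m a h (mgonal_form m a x).
  apply: mgonal_form_eq => //; rewrite dilated_valueE -complete_square.
  apply: diag_formZ => i; rewrite tnth_mktuple /completed /T; ring.
apply/eqP; rewrite eqz_mod_dvd DN'.
have -> : dilated_value m a h (mgonal_form m a x) - dilated_value m a h N =
    T ^+ 2 * (mgonal_form m a x - N%:Z) by rewrite /dilated_value /T; ring.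
by rewrite dvdz_mull // -eqz_mod_dvd Fx.
Qed.

(** A finite-level condition which implies that the diagonal form has no
    nontrivial zero over the p-adic numbers, by infinite descent on the power
    of p dividing a primitive zero. *)
Definition anisotropic_at (p n : nat) (a : n.-tuple nat) : Prop :=
  forall y : 'I_n -> int,
    ((p ^ 2)%N%:Z %| diag_form a y)%Z -> forall i, (p%:Z %| y i)%Z.

Lemma anisotropic_descent (p n : nat) (a : n.-tuple nat) :
  (0 < p)%N -> anisotropic_at p a ->
  forall (k : nat) (y : 'I_n -> int),
  (p%:Z ^+ k ^+ 2 %| diag_form a y)%Z -> forall i, (p%:Z ^+ k %| y i)%Z.
Proof.
move=> p_gt0 anis; have p_neq0 : p%:Z != 0 by lia.
elim=> [|k IHk] y; first by move=> _ i; rewrite expr0 dvd1z.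
rewrite (exprS p%:Z) exprMn => dvdF.
have dvdy : forall i, (p%:Z %| y i)%Z.
  by apply: anis; rewrite PoszX; apply: dvdz_trans dvdF; rewrite dvdz_mulr.
move: dvdF; have yE i : y i = p%:Z * (y i %/ p%:Z)%Z by rewrite mulrC divzK.
rewrite (diag_formZ a yE) dvdz_mul2l ?expf_neq0 //= => /IHk dvdz i.
by rewrite (yE i) dvdz_mul2l.
Qed.

(** By anisotropy a solution y for N' is T w; as T = 1 modulo 8 (m - 2), the
    vector w lies in the same residue class as y, so it comes from a solution
    for N. *)
Lemma represents_undilated (m : int) (n p k : nat) (a : n.-tuple nat)
    (h : int) (N N' : nat) :
  3 <= m -> (0 < p)%N -> anisotropic_at p a ->
  p%:Z ^+ k = 1 + 8 * (m - 2) * h -> N'%:Z = dilated_value m a h N ->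
  represents [set: int] m a N' -> represents [set: int] m a N.
Proof.
move=> m3 p_gt0 anis Dpk DN' [z [_ Fz]].
set y := fun i => completed m (tnth z i).
have Dy : diag_form a y =
    (p%:Z ^+ k) ^+ 2 * (8 * (m - 2) * N%:Z + (m - 4) ^+ 2 * coef_sum a).
  by rewrite complete_square Fz DN' dilated_valueE Dpk.
have dvdy : forall i, (p%:Z ^+ k %| y i)%Z.
  by apply: (anisotropic_descent p_gt0 anis (y := y)); rewrite Dy dvdz_mulr.
set w := fun i => (y i %/ p%:Z ^+ k)%Z.
have yE i : y i = p%:Z ^+ k * w i by rewrite mulrC divzK.
have T_neq0 : p%:Z ^+ k ^+ 2 != 0 by rewrite !expf_neq0 //; lia.
(* This is the x for which 2 (m - 2) x - (m - 4) = w, since T w = y. *)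
exists [tuple tnth z i - 4 * h * w i | i < n]; split=> //.
apply: mgonal_form_eq => //.
apply: (mulfI T_neq0); rewrite -Dy; apply/esym/diag_formZ => i.
rewrite yE tnth_mktuple; congr (_ * _).
have := yE i; rewrite Dpk /y /completed => yi.
have -> : 2 * (m - 2) * (tnth z i - 4 * h * w i) - (m - 4) =
  (2 * (m - 2) * tnth z i - (m - 4)) - 8 * (m - 2) * h * w i by ring.
by rewrite yi; ring.
Qed.

(** The powers T = p^k with k a multiple of totient (8 |m - 2|) are 1 modulo
    8 (m - 2), and the corresponding dilated values of N are unbounded. *)
Lemma anisotropic_not_almost_regular (D : set int) (m : int) (n p N : nat)
    (a : n.-tuple nat) :
  3 <= m -> prime p -> coprime p (8 * `|m - 2|) -> anisotropic_at p a ->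
  (0 < N)%N -> locally_represents m a N -> ~ represents [set: int] m a N ->
  ~ almost_regular D m a.
Proof.
move=> m3 p_pr co_p anis N_gt0 locN repN; apply: unbounded_infinite => b.
set k := (totient (8 * `|m - 2|) * b.+1)%N.
have [h Dpk] : exists h : nat, (p ^ k = 1 + 8 * `|m - 2| * h)%N.
  have := Euler_exp_totient co_p.
  move=> /(congr1 (fun c => (c ^ b.+1) %% (8 * `|m - 2|))%N).
  rewrite !modnXm -expnM exp1n -/k => E.
  exists (p ^ k %/ (8 * `|m - 2|))%N.
  rewrite {1}(divn_eq (p ^ k) (8 * `|m - 2|)) E modn_small; lia.
have Dm : `|m - 2|%N%:Z = m - 2 by lia.
have DpkZ : p%:Z ^+ k = 1 + 8 * (m - 2) * h%:Z by rewrite -PoszX Dpk -Dm; lia.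
have S_ge0 : 0 <= coef_sum a by apply: sumr_ge0.
have val_gt : b%:Z < dilated_value m a h N.
  have lt_bp : b%:Z < p%:Z ^+ k.
    rewrite -PoszX ltz_nat (leq_trans (ltnSn b)) //.
    rewrite (leq_trans (ltnW (ltn_expl _ (prime_gt1 p_pr)))) //.
    by rewrite leq_exp2l ?prime_gt1 // leq_pmull // totient_gt0; lia.
  rewrite /dilated_value -DpkZ ltr_wpDr //.
    have mh_ge0 : 0 <= (m - 2) * h%:Z by rewrite mulr_ge0 //; lia.
    rewrite mulr_ge0 // mulr_ge0 ?sqr_ge0 // mulr_ge0 //.
    by clear -mh_ge0; lia.
  by move: (p%:Z ^+ k) lt_bp => T lt_bT; clear -lt_bT N_gt0; nia.
have [N' DN'] : exists N' : nat, N'%:Z = dilated_value m a h N.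
  by exists `|dilated_value m a h N|%N; lia.
exists N'; last by lia.
split; first by lia.
- exact: locally_represents_dilated DN' locN.
- move=> [x [_ Fx]]; apply: repN.
  apply: (represents_undilated m3 (prime_gt0 p_pr) anis DpkZ DN').
  by exists x.
Qed.

(** * A value represented locally but not globally *)

(** P_m takes non-negative integral values, so a single nonzero term already
    exceeds N. *)
Lemma not_represents_small (D : set int) (m : int) (n : nat)
    (a : n.-tuple nat) (N : nat) :
  3 <= m -> (0 < N)%N -> (forall i, (N < tnth a i)%N) ->
  ~ represents D m a N.
Proof.
move=> m3 N_gt0 lt_Na [x [_ Fx]].
have P_ge0 i := polygonal_ge0 (tnth x i) m3.
have P0 i : polygonal m (tnth x i) = 0.
  have : (tnth a i)%:Z * polygonal m (tnth x i) <= N%:Z.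
    rewrite -Fx /mgonal_form (bigD1 i) //= lerDl sumr_ge0 // => j _.
    exact: mulr_ge0.
  by have := P_ge0 i; have := lt_Na i; nia.
by move: Fx; rewrite /mgonal_form big1 => [|i _]; [lia | rewrite P0 mulr0].
Qed.

Lemma inverse_and_zero_mod (s R1 R2 : nat) :
  coprime (s * R2) R1 ->
  exists v : int, (R1%:Z %| s%:Z * v - 1)%Z /\ (R2%:Z %| v)%Z.
Proof.
move=> co; have [u [v uv]] := Bezoutz (s * R2)%N R1.
exists (R2%:Z * u); rewrite dvdz_mulr //; split=> //.
have -> : 1 = u * (s * R2)%N%:Z + v * R1.
  by rewrite uv; move: co; rewrite /coprime => /eqP; rewrite /gcdz /= => ->.
rewrite (_ : _ - _ = - v * R1%:Z) ?dvdz_mull // PoszM; ring.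
Qed.

Lemma mgonal_form4 (m : int) (a b c d : nat) (x y z w : int) :
  mgonal_form m [tuple a; b; c; d] [tuple x; y; z; w] =
  a%:Z * polygonal m x + b%:Z * polygonal m y + c%:Z * polygonal m z
    + d%:Z * polygonal m w.
Proof.
by rewrite /mgonal_form !big_ord_recl big_ord0 !(tnth_nth 0%N) !(tnth_nth 0) /=;
  ring.
Qed.

Lemma polygonal0 (m : int) : polygonal m 0 = 0.
Proof. by have := double_polygonal m 0; lia. Qed.

(** Modulo R, the integer e v plays the part of e / s, at which s^2 P_m takes the
    value N, while f w = 0 contributes nothing. The factor 2 clears the
    denominator of P_m, which is why no parity condition on R is needed. *)
Lemma dvdz_two_squares_value (m : int) (R s t : nat) (e f v w N : int) :
  2 * N = (m - 2) * e ^+ 2 - (m - 4) * (e * s%:Z) ->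
  (R%:Z %| s%:Z * v - 1)%Z -> (R%:Z %| w)%Z ->
  (R%:Z %| 2 * ((s ^ 2)%N%:Z * polygonal m (e * v)
                + (t ^ 2)%N%:Z * polygonal m (f * w) - N))%Z.
Proof.
move=> DN Rv Rw.
have -> : 2 * ((s ^ 2)%N%:Z * polygonal m (e * v)
               + (t ^ 2)%N%:Z * polygonal m (f * w) - N) =
    (s ^ 2)%N%:Z * (2 * polygonal m (e * v))
    + (t ^ 2)%N%:Z * (2 * polygonal m (f * w)) - 2 * N by ring.
rewrite !double_polygonal DN !PoszX.
have -> : s%:Z ^+ 2 * ((m - 2) * (e * v) ^+ 2 - (m - 4) * (e * v))
    + t%:Z ^+ 2 * ((m - 2) * (f * w) ^+ 2 - (m - 4) * (f * w))
    - ((m - 2) * e ^+ 2 - (m - 4) * (e * s%:Z)) =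
    ((m - 2) * e ^+ 2 * (s%:Z * v + 1) - (m - 4) * (e * s%:Z))
      * (s%:Z * v - 1)
    + t%:Z ^+ 2 * ((m - 2) * f ^+ 2 * w - (m - 4) * f) * w by ring.
by rewrite rpredD // dvdz_mull.
Qed.

(** The equalities say N = s^2 P_m(e / s) = t^2 P_m(f / t). The modulus 2 r is
    split into R1, prime to s, and R2, composed of primes dividing s and hence
    prime to t; the first fraction is used modulo R1, the second modulo R2. *)
Lemma locally_represents_two_squares (m : int) (s t c d N : nat) (e f : int) :
  (0 < s)%N -> (0 < t)%N -> coprime s t ->
  2 * N%:Z = (m - 2) * e ^+ 2 - (m - 4) * (e * s%:Z) ->
  2 * N%:Z = (m - 2) * f ^+ 2 - (m - 4) * (f * t%:Z) ->
  locally_represents m [tuple (s ^ 2)%N; (t ^ 2)%N; c; d] N.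
Proof.
move=> s_gt0 t_gt0 co_st DNe DNf r r_gt0.
pose R1 := ((2 * r)`_(\pi(s)^'))%N; pose R2 := ((2 * r)`_\pi(s))%N.
have R_gt0 : (0 < 2 * r)%N by rewrite muln_gt0.
have DR : (R2 * R1 = 2 * r)%N by rewrite partnC.
have co_R : coprime R2 R1 by rewrite coprime_partC.
have co_s : coprime s R1 
  by apply: (@pnat_coprime \pi(s)); [exact: pnat_pi | exact: part_pnat].
have co_t : coprime t R2.
  rewrite coprime_sym; apply: (@pnat_coprime \pi(s)); first exact: part_pnat.
  by rewrite -coprime_pi'.
have [|v [R1v R2v]] := @inverse_and_zero_mod s R1 R2.
  by rewrite coprimeMl co_s.
have [|w [R2w R1w]] := @inverse_and_zero_mod t R2 R1.
  by rewrite coprimeMl co_t coprime_sym.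
exists [tuple e * v; f * w; 0; 0].
apply/eqP; rewrite eqz_mod_dvd mgonal_form4 polygonal0 !mulr0 !addr0.
rewrite -(@dvdz_mul2l 2) //.
have -> : 2 * r%:Z = R2%:Z * R1%:Z by rewrite -PoszM DR PoszM.
rewrite Gauss_dvdz //; apply/andP; split.
  by rewrite [X in X - _]addrC; apply: dvdz_two_squares_value.
exact: dvdz_two_squares_value.
Qed.

(** Modulo p only (s y0)^2 + (t y1)^2 survives, which forces p to divide y0 and
    y1; then modulo p^2 only p u (y2^2 + y3^2) survives. *)
Lemma anisotropic_two_squares (p s t u : nat) :
  prime p -> (p %% 4 = 3)%N -> coprime p s -> coprime p t -> coprime p u ->
  anisotropic_at p [tuple (s ^ 2)%N; (t ^ 2)%N; (p * u)%N; (p * u)%N].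
Proof.
move=> p_pr p3 co_s co_t co_u y.
rewrite /diag_form !big_ord_recl big_ord0 !(tnth_nth 0%N) /= addr0.
set y0 := y _; set y1 := y _; set y2 := y _; set y3 := y _ => dvdF.
have p_neq0 : p%:Z != 0 by have := prime_gt0 p_pr; lia.
have co_dvd (c : nat) (z : int) : coprime p c ->
    (p%:Z %| c%:Z * z)%Z -> (p%:Z %| z)%Z.
  by move=> co; rewrite Gauss_dvdzr.
have [py0 py1] : (p%:Z %| y0)%Z /\ (p%:Z %| y1)%Z.
  have [|p0 p1] := @dvdz_sqr_sum_3mod4 p (s%:Z * y0) (t%:Z * y1) p_pr p3.
    have -> : (s%:Z * y0) ^+ 2 + (t%:Z * y1) ^+ 2 =
      ((s ^ 2)%N%:Z * y0 ^+ 2 + ((t ^ 2)%N%:Z * y1 ^+ 2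
        + ((p * u)%N%:Z * y2 ^+ 2 + (p * u)%N%:Z * y3 ^+ 2)))
      - p%:Z * (u%:Z * (y2 ^+ 2 + y3 ^+ 2)) by rewrite !PoszX !PoszM; ring.
    rewrite rpredB ?dvdz_mulr //; apply: dvdz_trans dvdF.
    by rewrite PoszX expr2 dvdz_mulr.
  by split; [apply: co_dvd p0 | apply: co_dvd p1].
have [py2 py3] : (p%:Z %| y2)%Z /\ (p%:Z %| y3)%Z.
  apply: dvdz_sqr_sum_3mod4 => //; apply: (co_dvd u) => //.
  rewrite -(dvdz_mul2l p_neq0).
  have -> : p%:Z * (u%:Z * (y2 ^+ 2 + y3 ^+ 2)) =
      ((s ^ 2)%N%:Z * y0 ^+ 2 + ((t ^ 2)%N%:Z * y1 ^+ 2
        + ((p * u)%N%:Z * y2 ^+ 2 + (p * u)%N%:Z * y3 ^+ 2)))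
      - ((s ^ 2)%N%:Z * y0 ^+ 2 + (t ^ 2)%N%:Z * y1 ^+ 2).
    by rewrite !PoszM; ring.
  rewrite rpredB -?expr2 -?PoszX // rpredD // dvdz_mull // PoszX;
    exact: dvdz_exp2r.
case=> [[|[|[|[|//]]]] lt_i].
- by rewrite (_ : Ordinal _ = ord0) //; apply: val_inj.
- by rewrite (_ : Ordinal _ = lift ord0 ord0) //; apply: val_inj.
- by rewrite (_ : Ordinal _ = lift ord0 (lift ord0 ord0)) //; apply: val_inj.
- by rewrite (_ : Ordinal _ = lift ord0 (lift ord0 (lift ord0 ord0))) //;
    apply: val_inj.
Qed.

(** Put n = m - 2. The choice e + f = n - 2, s = n + f w, t = n + e w solves
      n e^2 - (n - 2) e s = n f^2 - (n - 2) f t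
    for every w, and both sides equal - e f (n + (n - 2) w). For n > 1 the
    witnesses come from f = - 1 and w = 2 n^2 + 1, with the signs of e and s
    reversed to make s positive; then t = (n - 1) s + n^2 and s = 1 modulo n,
    whence coprimality. For n = 1 this choice has e = 0, so
    m = 3 is treated apart. *)
Lemma common_value_exists (m : int) : 3 <= m ->
  exists s t N : nat, exists e f : int,
  [/\ coprime s t, (0 < N)%N, (N < s ^ 2)%N /\ (N < t ^ 2)%N,
      2 * N%:Z = (m - 2) * e ^+ 2 - (m - 4) * (e * s%:Z)
    & 2 * N%:Z = (m - 2) * f ^+ 2 - (m - 4) * (f * t%:Z)].
Proof.
move=> m3; have [->|m_neq3] := eqVneq m 3.
  by exists 4%N, 11%N, 6%N, 2, 1.
have [k ->] : exists k : nat, m = k%:Z + 4 by exists `|m - 4|%N; lia.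
set s := (k.+2 * (2 * k + 3) + 1)%N; set t := (k.+1 * s + k.+2 ^ 2)%N.
exists s, t, (k.+1 * (k ^ 3 + 4 * k ^ 2 + 5 * k + 1))%N.
exists (- k.+1%:Z), (-1).
split.
- rewrite /t /coprime gcdnMDl -/(coprime _ _) coprimeXr // coprime_sym.
  by rewrite /s /coprime mulnC gcdnMDl gcdn1.
- nia.
- by rewrite /t /s; split; nia.
- by rewrite /s; lia.
- by rewrite /t /s; lia.
Qed.

Theorem theorem1p2 (m : int) (hm : 3 <= m) :
  infinite_set [set a : 4.-tuple nat |
    [/\ positive_coefs a, primitive a,
        ~ almost_regular [set: int] m a
      & ~ almost_regular nonneg_int m a]].
Proof.
have [s [t [N [e [f [co_st N_gt0 [lt_Ns lt_Nt] DNe DNf]]]]]] :=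
  common_value_exists hm.
have s_gt0 : (0 < s)%N by case: s lt_Ns {co_st DNe} => //; lia.
have t_gt0 : (0 < t)%N by case: t lt_Nt {co_st DNf} => //; lia.
(* Any prime divisor of 4 c - 1 is prime to 2, m - 2, s and t. *)
set c := (`|m - 2| * s * t)%N.
have c_gt0 : (0 < c)%N by rewrite !muln_gt0 s_gt0 t_gt0; lia.
have [p [p_pr p3 pc]] : exists p : nat,
    [/\ prime p, (p %% 4 = 3)%N & (p %| 4 * c - 1)%N].
  by apply: prime_divisor_3mod4; lia.
have co_pc : coprime p (4 * c).
  apply: (coprime_dvdl pc); rewrite coprime_sym.
  by rewrite -{1}(@subnK 1 (4 * c)) ?addn1 ?coprimeSn //; lia.
have [co_p4 co_pm co_ps co_pt] :
    [/\ coprime p 4, coprime p `|m - 2|, coprime p s & coprime p t].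
  by move: co_pc; rewrite !coprimeMr -!andbA => /and4P.
pose a u : 4.-tuple nat := [tuple (s ^ 2)%N; (t ^ 2)%N; (p * u)%N; (p * u)%N].
move=> /(finite_image (fun b : 4.-tuple nat => nth 0%N b 2)).
apply: unbounded_infinite => b.
(* This u is prime to p and makes p u exceed both N and the bound b. *)
set u := (p * (N + b) + 1)%N.
have co_pu : coprime p u by rewrite /u /coprime mulnC gcdnMDl gcdn1.
have p_gt0 := prime_gt0 p_pr.
have lt_pu : (N + b < p * u)%N.
  by rewrite (@leq_trans u) ?leq_pmull // /u addn1 ltnS leq_pmull.
exists (p * u)%N; last by rewrite (leq_ltn_trans (leq_addl N b)).
have lt_Npu := leq_ltn_trans (leq_addr b N) lt_pu.
have lt_Na i : (N < tnth (a u) i)%N.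
  by rewrite (tnth_nth 0%N); case: i => [[|[|[|[|//]]]] lt_i].
have notreg D : ~ almost_regular D m (a u).
  apply: (anisotropic_not_almost_regular (p := p) (N := N)) => //.
  - by rewrite coprimeMr co_pm -[8%N]/(4 * 2)%N coprimeMr co_p4 /= andbT;
      move: co_p4; rewrite -[4%N]/(2 * 2)%N coprimeMr => /andP[].
  - exact: anisotropic_two_squares.
  - exact: locally_represents_two_squares DNe DNf.
  - exact: (not_represents_small hm N_gt0 lt_Na).
exists (a u) => //; split=> //.
- by move=> i; apply: leq_ltn_trans (lt_Na i).
- rewrite /primitive !big_ord_recl big_ord0 !(tnth_nth 0%N) /= gcdnA.
  have /eqP -> : coprime (s ^ 2) (t ^ 2) by rewrite coprimeXl // coprimeXr.
  by rewrite gcd1n.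
Qed.
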